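(* Let $n\geq 6$ be an even positive integer and let $\mathcal{A}\subseteq\mathbb{Z}_{n}$ be a subset with $|\mathcal{A}|\geq \frac{n}{2}+3$. Then $4^{\wedge}\mathcal{A}=5^{\wedge}\mathcal{A}=\mathbb{Z}_{n}$.
   Context: $\mathbb{Z}_n$ denotes the additive cyclic group of integers modulo $n$. For a positive integer $h\ge 2$ and a subset $\mathcal{A}$ of $\mathbb{Z}_n$, $h^{\wedge}\mathcal{A}$ denotes the set of elements of $\mathbb{Z}_n$ that can be written as a sum of $h$ pairwise distinct elements of $\mathcal{A}$. *)

(* Defs.v *)
From mathcomp Require Import all_boot all_algebra.

Set Implicit Arguments.
Unset Strict Implicit.
Unset Printing Implicit Defensive.

(* h^A: a choice of h pairwise distinct elements of A is a subset B of A with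
   exactly h elements. *)
Definition restricted_sumset (V : finZmodType) (h : nat) (A : {set V}) : {set V} :=
  [set (\sum_(x in B) x)%R | B : {set V} & (B \subset A) && (#|B| == h)].

(* Main.v *)
Require Import Defs.
From mathcomp Require Import all_boot all_algebra zify.

(** The argument is counting by inclusion-exclusion.  If [2|A| >= |V| + 6], then
    for every [g] the sets [A] and [g - A] share at least six elements
    ([card_summands_ge6]): their intersection [P_g] consists of the members of
    the pairs in [A] of sum [g].  In [Z_n] with [n] even an equation [x + x = g]
    has at most two solutions ([card_Zp_halves]), and none for [g = 1]
    ([Zp_double_neq1]).  Hence [P_1] is made of at least three disjoint pairs of
    distinct elements, while every [P_g] still contains such a pair after one
    further element of [A] has been forbidden ([exists_pair_avoiding]).

    Four summands: write [h - 1 = c + d] with [c <> d] in [A].  The pairs of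
    sum [1] that meet [{c, d}] use at most four elements of [P_1], so
    some pair of sum [1] avoids [c] and [d].

    Five summands: write [h - 1 = c + d + e] instead; three pairs may now be
    spoiled, which is one too many if [|P_1| = 6].  But [c] can be chosen freely
    in [A].  If some [c] in [A] lies outside [P_1], it spoils no pair, and [d] and
    [e] spoil at most two; otherwise [P_1 = A] has at least seven elements as soon
    as [n >= 8].  For [n = 6] the set [A] is the whole group, and a sum of
    [5 = n - 1] distinct elements is the sum of the group minus an arbitrary
    element. *)

Set Implicit Arguments.
Unset Strict Implicit.
Unset Printing Implicit Defensive.

Import GRing.Theory.
Local Open Scope ring_scope.

(** * Sums of distinct elements in a finite abelian group *)

Lemma mem_restricted_sumset (V : finZmodType) (A : {set V}) (s : seq V) :
  uniq s -> {subset s <= A} ->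
  \sum_(x <- s) x \in restricted_sumset (size s) A.
Proof.
move=> us sA; apply/imsetP; exists [set x in s].
  rewrite inE; apply/andP; split.
    by apply/subsetP => x; rewrite inE => /sA.
  by rewrite cardsE; apply/eqP/card_uniqP.
by rewrite big_uniq //=; apply: eq_bigl => x; rewrite inE.
Qed.

(** Leaving out the element [t - h], where [t] is the sum of the whole group,
    leaves a sum equal to [h]. *)
Lemma restricted_sumset_card_pred (V : finZmodType) :
  restricted_sumset #|V|.-1 [set: V] = [set: V].
Proof.
apply/setP => h; rewrite inE; apply/imsetP.
exists [set~ (\sum_(x : V) x) - h].
  by rewrite inE subsetT cardsC1 eqxx.
set t := \sum_x x.
have tE : t = t - h + \sum_(x in [set~ t - h]) x.
  rewrite {1}/t (bigD1 (t - h)) //=; congr (_ + _).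
  by apply: eq_bigl => x; rewrite !inE.
by apply: (addrI (t - h)); rewrite -tE subrK.
Qed.

Definition summands (V : finZmodType) (A : {set V}) (g : V) : {set V} :=
  [set x in A | g - x \in A].

Lemma card_summands_ge6 (V : finZmodType) (A : {set V}) (g : V) :
  (#|V| + 6 <= #|A| + #|A|)%N -> (6 <= #|summands A g|)%N.
Proof.
move=> cA; rewrite -(leq_add2l #|V|); apply: leq_trans cA _.
have inj : injective (fun x : V => g - x) by move=> x y /addrI /oppr_inj.
have cB : #|[set x | g - x \in A]| = #|A|.
  rewrite -(card_imset A inj); congr #|pred_of_set _|; apply/setP => x.
  rewrite inE; apply/idP/imsetP => [Agx | [y Ay ->]]; last by rewrite subKr.
  by exists (g - x); rewrite ?subKr.
rewrite -{2}cB -cardsUI leq_add ?max_card //.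
by apply: subset_leq_card; apply/subsetP => x; rewrite !inE.
Qed.

(** Besides its diagonal elements [x + x = g], a set [summands A g] of at least
    six elements loses only [c] and [g - c] when [c] is forbidden, because
    [x |-> g - x] permutes it. *)
Lemma exists_pair_avoiding (V : finZmodType) (A : {set V}) (g c : V) :
  (#|V| + 6 <= #|A| + #|A|)%N -> (#|[set x : V | (x + x)%R == g]| <= 2)%N ->
  exists d e, [/\ d \in A, e \in A, d + e = g, d != e & c \notin [:: d; e]].
Proof.
move=> cA cD; have := card_summands_ge6 g cA.
set D := [set x | _] in cD; set P := summands A g => cP.
have /subsetPn[x Px] : ~~ (P \subset D :|: [set c; g - c]).
  apply/negP => /subset_leq_card; have [+ _] := leq_card_setU D [set c; g - c].
  rewrite cards2; have := leq_b1 (c != g - c); lia.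
rewrite !inE !negb_or => /and3P[xx xc xgc].
move: Px; rewrite inE => /andP[Ax Agx].
exists x, (g - x); split=> //; first by rewrite addrC subrK.
  by rewrite eq_sym subr_eq eq_sym.
rewrite !inE negb_or eq_sym xc /=; apply: contra xgc => /eqP ->.
by rewrite subKr.
Qed.

(** A pair [{x, g - x}] meets [s] only if [x] lies in [s] or in [g - s]; any other
    pair in [A] extends [s] by two new summands, distinct because [g] is not a
    double. *)
Lemma mem_restricted_sumset_pair (V : finZmodType) (A : {set V}) (g : V)
    (s : seq V) :
  (forall x, x + x != g) -> uniq s -> {subset s <= A} ->
  ~~ (summands A g \subset s ++ [seq g - x | x <- s]) ->
  g + \sum_(x <- s) x \in restricted_sumset (size s).+2 A.
Proof.
move=> godd us sA /subsetPn[x]; rewrite inE => /andP[Ax Agx].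
rewrite mem_cat negb_or => /andP[xs xgs].
have -> : g + \sum_(y <- s) y = \sum_(y <- [:: x, g - x & s]) y.
  by rewrite !big_cons addrA [x + _]addrC subrK.
apply: (mem_restricted_sumset (s := [:: x, g - x & s])) => /=.
  rewrite us andbT inE negb_or xs andbT; apply/andP; split.
    by rewrite eq_sym subr_eq eq_sym.
  by apply: contra xgs => ?; apply/mapP; exists (g - x); rewrite ?subKr.
by move=> y; rewrite !inE => /or3P[/eqP->|/eqP->|/sA].
Qed.

Section Full.

Variables (V : finZmodType) (A : {set V}) (g0 : V).
Hypothesis g0_odd : forall x, x + x != g0.
Hypothesis card_halves : forall g, (#|[set x : V | (x + x)%R == g]| <= 2)%N.
Hypothesis card_A : (#|V| + 6 <= #|A| + #|A|)%N.

Lemma restricted_sumset4_full : restricted_sumset 4 A = [set: V].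
Proof.
apply/setP => h; rewrite inE.
(* [0] is an arbitrary choice of forbidden element. *)
have [c [d [Ac Ad scd cd _]]] :=
  exists_pair_avoiding 0 card_A (card_halves (h - g0)).
have -> : h = g0 + \sum_(x <- [:: c; d]) x.
  by rewrite !big_cons big_nil addr0 scd addrC subrK.
apply: mem_restricted_sumset_pair => //=.
- by rewrite inE cd.
- by move=> y; rewrite !inE => /orP[] /eqP->.
apply/negP => /subset_leq_card /leq_trans /(_ (card_size _)).
by move/(leq_trans (card_summands_ge6 g0 card_A)).
Qed.

Lemma restricted_sumset5_full :
  (6 < #|A|)%N -> restricted_sumset 5 A = [set: V].
Proof.
move=> A_gt6; apply/setP => h; rewrite inE.
have cP := card_summands_ge6 g0 card_A; set P := summands A g0 in cP.
(* This [c] is kept away from the pairs of sum [g0] whenever possible. *)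
have [c Ac cAP] : exists2 c, c \in A & (c \notin P) || (A \subset P).
  have [AP|/subsetPn[c Ac cP']] := boolP (A \subset P); last first.
    by exists c; rewrite ?cP'.
  have /card_gt0P[c Ac] : (0 < #|A|)%N by lia.
  by exists c; rewrite ?orbT.
have [d [e [Ad Ae sde de]]] :=
  exists_pair_avoiding c card_A (card_halves (h - g0 - c)).
rewrite !inE => cde.
have -> : h = g0 + \sum_(x <- [:: c; d; e]) x.
  by rewrite !big_cons big_nil addr0 sde [c + _]addrC subrK addrC subrK.
apply: mem_restricted_sumset_pair => //=.
- by rewrite !inE cde de.
- by move=> y; rewrite !inE => /or3P[] /eqP->.
rewrite -/P; apply/negP => sub; case/orP: cAP => [cNP | /subset_leq_card AP].
  have {sub} : P \subset [:: d; e; g0 - d; g0 - e].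
    apply/subsetP => x Px; have := subsetP sub x Px; rewrite !inE.
    have /negbTE-> /= : x != c by apply: contraNneq cNP => <-.
    have /negbTE-> // : x != g0 - c.
    apply: contraNneq cNP => xE; move: Px; rewrite !inE xE subKr.
    by rewrite andbC.
  by move=> /subset_leq_card /leq_trans /(_ (card_size _)) /(leq_trans cP).
move: sub => /subset_leq_card /leq_trans /(_ (card_size _)).
by move/(leq_trans AP)/(leq_trans A_gt6).
Qed.

End Full.

(** * Doubling modulo an even number *)

Lemma modn_lt_double (k d : nat) :
  (k < d + d)%N -> (k %% d = if k < d then k else k - d)%N.
Proof.
move=> kdd; case: ltnP => [|dk]; first exact: modn_small.
by rewrite -{1}(subnK dk) modnDr modn_small // ltn_subLR.
Qed.

Lemma eq_addnn_mod (m a b : nat) :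
  (a < m.*2)%N -> (b < m.*2)%N -> a + a = b + b %[mod m.*2] -> a != b ->
  a = ((b + m) %% m.*2)%N.
Proof.
move=> am bm; rewrite !modn_lt_double; [|lia..].
by do !case: ltnP => ?; lia.
Qed.

Lemma val_Zp_add (n : nat) (x y : 'Z_n) :
  (1 < n)%N -> x + y = ((x + y) %% n)%N :> nat.
Proof. by move=> n_gt1; rewrite -[X in (_ %% X)%N](Zp_cast n_gt1). Qed.

Lemma Zp_double_eq (n : nat) (x y : 'Z_n) :
  (1 < n)%N -> ~~ odd n -> x + x = y + y -> x = y \/ x = y + (n./2)%:R.
Proof.
move=> n_gt1 n_even /(congr1 (@nat_of_ord _)); rewrite !val_Zp_add // => E.
have := ltn_ord y; rewrite [X in (_ < X)%N]Zp_cast // => yn.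
have := ltn_ord x; rewrite [X in (_ < X)%N]Zp_cast // => xn.
have [xy|xy] := eqVneq (x : nat) y; first by left; apply: ord_inj.
right; apply: ord_inj; rewrite val_Zp_add // val_Zp_nat // modnDmr.
have n2 : n = (n./2).*2 by rewrite even_halfK.
by have := @eq_addnn_mod n./2 x y; rewrite -n2; apply.
Qed.

Lemma card_Zp_halves (n : nat) (g : 'Z_n) :
  (1 < n)%N -> ~~ odd n -> (#|[set x : 'Z_n | (x + x)%R == g]| <= 2)%N.
Proof.
move=> n_gt1 n_even.
have [->|[y]] := set_0Vmem [set x : 'Z_n | x + x == g]; first by rewrite cards0.
rewrite inE => /eqP yg.
apply: (@leq_trans #|[set y; y + (n./2)%:R]|); last by rewrite cards2; case: eqP.
apply: subset_leq_card; apply/subsetP => x; rewrite !inE => /eqP xg.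
have [->|->] := Zp_double_eq n_gt1 n_even (etrans xg (esym yg));
  by rewrite eqxx ?orbT.
Qed.

Lemma Zp_double_neq1 (n : nat) (x : 'Z_n) :
  (1 < n)%N -> ~~ odd n -> x + x != 1.
Proof.
move=> n_gt1 n_even; apply/eqP => /(congr1 (@nat_of_ord _)).
rewrite val_Zp_add // (val_Zp_nat n_gt1 1) => /(congr1 odd).
by rewrite !odd_mod ?(negbTE n_even) // oddD addbb.
Qed.

Local Close Scope ring_scope.

Theorem theorem1p1 (n : nat) (hn : 6 <= n) (n_even : ~~ odd n)
  (A : {set 'Z_n}) (hA : n %/ 2 + 3 <= #|A|) :
  restricted_sumset 4 A = [set: 'Z_n] /\ restricted_sumset 5 A = [set: 'Z_n].
Proof.
have n_gt1 : 1 < n by lia.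
have cV : #|'Z_n| = n by rewrite card_ord Zp_cast.
have cA : #|'Z_n| + 6 <= #|A| + #|A| by rewrite cV; lia.
have odd1 (x : 'Z_n) := Zp_double_neq1 x n_gt1 n_even.
have halves (g : 'Z_n) := card_Zp_halves g n_gt1 n_even.
split; first exact: restricted_sumset4_full odd1 halves cA.
have [A_gt6|A_le6] := ltnP 6 #|A|.
  exact: restricted_sumset5_full odd1 halves cA A_gt6.
have n6 : n = 6 by lia.
have -> : A = [set: 'Z_n].
  by apply/eqP; rewrite eqEcard subsetT cardsT cV; lia.
by rewrite -[RHS]restricted_sumset_card_pred cV n6.
Qed.
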